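(* Let $A^1,\ldots,A^n\in\mathbb R^{m\times k}$ ($n$ even) be an $(M,\gamma)$-well-bounded generalized load-balancing instance with $\gamma\ge1$ and optimal value $\lambda^*$. Suppose $\varepsilon\le 1/84$ and $\delta\in(0,\varepsilon]$ satisfy $\lambda^*\ge\frac{3M\log(m/\delta)}{\varepsilon^2}$. Let the matrices arrive in uniformly random order $\mathbf A^1,\ldots,\mathbf A^n$ and run algorithm ExpertLB with any prediction-with-experts algorithm having $(\alpha,R)$-regret (for reward vectors in $[-M,M]^m$). Then, with probability at least $1-\delta$, the produced online solution $\mathbf p^1,\ldots,\mathbf p^n\in\Delta^k$ satisfies \[\Big\|\sum_t\mathbf A^t\mathbf p^t-\alpha\sum_t\big|\mathbf A^t\mathbf p^t\big|\Big\|_{\max}\le\lambda^*(1+c_1\gamma\varepsilon)+2R,\] for a universal constant $c_1$. In particular, if the Multiplicative Weights Update algorithm with learning parameter $\varepsilon$ is used as the experts algorithm, then (for a slightly larger universal constant $c_1$), with probability at least $1-\delta$, \[\Big\|\sum_t\mathbf A^t\mathbf p^t-\varepsilon\sum_t\big|\mathbf A^t\mathbf p^t\big|\Big\|_{\max}\le\lambda^*(1+c_1\gamma\varepsilon).\]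
   Context: $\Delta^k=\{p\in[0,1]^k:\sum_jp_j=1\}$; for $v\in\mathbb R^m$, $\|v\|_{\max}=\max_iv_i$ and $|v|=(|v_1|,\ldots,|v_m|)$. Generalized load balancing: given $A^1,\ldots,A^n\in\mathbb R^{m\times k}$, the optimal value is $\lambda^*=\min\{\|\sum_tA^tp^t\|_{\max}:p^t\in\Delta^k\}$. In the online random-order version, only $n$ is known upfront; $\mathbf A^1,\ldots,\mathbf A^n$ are sampled uniformly without replacement from $\{A^1,\ldots,A^n\}$, and at time $t$ the algorithm must choose $\mathbf p^t\in\Delta^k$ knowing only $\mathbf A^1,\ldots,\mathbf A^t$. The instance is $(M,\gamma)$-well-bounded if all $A^t_{ij}\in[-M,M]$ and for each row $i$ either $A^t_{ij}\ge-\gamma\lambda^*/n$ for all $j,t$, or $A^t_{ij}\le\gamma\lambda^*/n$ for all $j,t$. Prediction-with-experts: vectors $o^1,\ldots,o^n\in[-M,M]^m$ are revealed one at a time (adversarially); before seeing $o^t$, the algorithm chooses $w^t\in\Delta^m$ based on $o^1,\ldots,o^{t-1}$ and gains $\langle w^t,o^t\rangle$. It has $(\alpha,R)$-regret if for every sequence $\sum_t\langle w^t,o^t\rangle\ge\|\sum_to^t-\alpha\sum_t|o^t|\|_{\max}-R$. The Multiplicative Weights Update algorithm with learning parameter $\varepsilon\in[0,1]$ has $(\varepsilon,\frac{M\log m}{\varepsilon})$-regret. Algorithm ExpertLB (given $n,M,\varepsilon$ and an experts algorithm): for each $t=1,\ldots,n$: on arrival of $\mathbf A^t$, with current experts state $\mathbf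 w^t\in\Delta^m$, choose $\mathbf p^t\in\Delta^k$ minimizing $(\mathbf w^t)^\top\mathbf A^t\mathbf p^t$; feed $\mathbf A^t\mathbf p^t$ to the experts algorithm and let $\mathbf w^{t+1}$ be its new state; if $t=n/2$, restart the experts algorithm from its initial state. *)

(* Defs.v *)
From HB Require Import structures.
From mathcomp Require Import all_boot all_order all_algebra all_fingroup.
From mathcomp Require Import all_classical all_reals all_analysis.

Set Implicit Arguments.
Unset Strict Implicit.
Unset Printing Implicit Defensive.

Import Order.TTheory GRing.Theory Num.Theory.
Import numFieldNormedType.Exports.

Local Open Scope classical_set_scope.
Local Open Scope ring_scope.

Definition simplex (R : realType) (k : nat) : set 'cV[R]_k :=
  [set p | (forall j, 0 <= p j 0 <= 1) /\ \sum_j p j 0 = 1].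

(* The signed maximum max_i v_i, not a norm; the dimension is a successor so
   that the maximum is over a nonempty range. *)
Definition vmax (R : realType) (m : nat) (v : 'cV[R]_m.+1) : R :=
  \big[Num.max/v ord0 0]_(i < m.+1) v i 0.

(* Entrywise absolute value: the library's `|v| is the sup norm. *)
Definition vabs (R : realType) (m : nat) (v : 'cV[R]_m) : 'cV[R]_m :=
  map_mx (fun x : R => `|x|) v.

Definition in_box (R : realType) (m : nat) (M : R) (o : 'cV[R]_m) : Prop :=
  forall i, - M <= o i 0 <= M.

(* Optimal value of the offline problem. The infimum is a minimum, see
   [opt_value_min] below. *)
Definition opt_value (R : realType) (n m k : nat)
    (A : 'I_n -> 'M[R]_(m.+1, k.+1)) : R :=
  inf [set vmax (\sum_t A t *m p t) |
        p in [set p : 'I_n -> 'cV[R]_k.+1 | forall t, simplex (p t)]].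

Definition well_bounded (R : realType) (n m k : nat) (M gamma : R)
    (A : 'I_n -> 'M[R]_(m.+1, k.+1)) : Prop :=
  (forall t i j, - M <= A t i j <= M) /\
  (forall i,
     (forall t j, - (gamma * opt_value A / n%:R) <= A t i j) \/
     (forall t j, A t i j <= gamma * opt_value A / n%:R)).

(* An experts algorithm maps the list of reward vectors revealed so far
   (oldest first) to its current distribution over the experts. *)
Definition experts_algorithm (R : realType) (m : nat) (M : R)
    (w : seq 'cV[R]_m -> 'cV[R]_m) : Prop :=
  forall h : seq 'cV[R]_m, (forall o, o \in h -> in_box M o) -> simplex (w h).

(* (alpha, Rg)-regret on sequences o 0, ..., o n.-1 of rewards in [-M, M]^m;
   shorter sequences are covered by padding with zero rewards. *)
Definition has_regret (R : realType) (n m : nat) (M : R)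
    (w : seq 'cV[R]_m.+1 -> 'cV[R]_m.+1) (alpha Rg : R) : Prop :=
  forall o : nat -> 'cV[R]_m.+1,
    (forall t, (t < n)%N -> in_box M (o t)) ->
    \sum_(t < n) ((w (mkseq o t))^T *m o t) 0 0 >=
      vmax (\sum_(t < n) o t - alpha *: \sum_(t < n) vabs (o t)) - Rg.

(* Multiplicative weights for gains in [-M, M]^m: uniform initial weights, and
   weight i is multiplied by 1 + eps * o_i / M on each reward vector o. *)
Definition mwu_weight (R : realType) (m : nat) (eps M : R)
    (h : seq 'cV[R]_m) (i : 'I_m) : R :=
  \prod_(o <- h) (1 + eps * (o i 0 / M)).

Definition mwu (R : realType) (m : nat) (eps M : R)
    (h : seq 'cV[R]_m) : 'cV[R]_m :=
  \col_i (mwu_weight eps M h i / \sum_j mwu_weight eps M h j).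

(* A way of choosing, at each time t and for each w and A, a minimizer of
   w^T A p over the simplex; ties are broken arbitrarily. *)
Definition minimizing_rule (R : realType) (m k : nat)
    (pick : nat -> 'cV[R]_m -> 'M[R]_(m, k) -> 'cV[R]_k) : Prop :=
  forall t w A, simplex (pick t w A) /\
    (forall q, simplex q ->
       (w^T *m A *m pick t w A) 0 0 <= (w^T *m A *m q) 0 0).

(* The list of decisions of ExpertLB on the arrivals As, from time t (times
   start at 1), when the experts algorithm w has been fed the rewards h since
   it was last (re)started. *)
Fixpoint expertLB_from (R : realType) (m k : nat) (n : nat)
    (w : seq 'cV[R]_m -> 'cV[R]_m)
    (pick : nat -> 'cV[R]_m -> 'M[R]_(m, k) -> 'cV[R]_k)
    (t : nat) (h : seq 'cV[R]_m) (As : seq 'M[R]_(m, k)) : seq 'cV[R]_k :=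
  match As with
  | [::] => [::]
  | A :: As' =>
      let p := pick t (w h) A in
      let h' := if t == n./2 then [::] else rcons h (A *m p) in
      p :: expertLB_from n w pick t.+1 h' As'
  end.

(* Decisions of ExpertLB when the matrices arrive in the order
   A (s 0), ..., A (s n.-1); entry t is the decision for A (s t). *)
Definition expertLB (R : realType) (n m k : nat)
    (w : seq 'cV[R]_m -> 'cV[R]_m)
    (pick : nat -> 'cV[R]_m -> 'M[R]_(m, k) -> 'cV[R]_k)
    (A : 'I_n -> 'M[R]_(m, k)) (s : 'S_n) : 'I_n -> 'cV[R]_k :=
  fun t => nth 0 (expertLB_from n w pick 1 [::] [seq A (s u) | u : 'I_n]) t.

Definition discounted_load (R : realType) (n m k : nat) (alpha : R)
    (A : 'I_n -> 'M[R]_(m.+1, k)) (p : 'I_n -> 'cV[R]_k) : R :=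
  vmax (\sum_t A t *m p t - alpha *: \sum_t vabs (A t *m p t)).

(* Probability of an event for a uniformly random arrival order. *)
Definition prob_order (R : realType) (n : nat) (E : {set 'S_n}) : R :=
  #|E|%:R / #|{: 'S_n}|%:R.
Arguments prob_order R {n} E.

Section OptValueMin.
Variables (R : realType) (n m k : nat).

Let continuous_bigmax (T : topologicalType) (I : Type) (r : seq I)
    (g : T -> R) (f : I -> T -> R) :
  continuous (g : T -> R^o) -> (forall i, continuous (f i : T -> R^o)) ->
  continuous ((fun x => \big[Num.max/g x]_(i <- r) f i x) : T -> R^o).
Proof.
move=> cg cf; elim: r => [|i r IH].
  by rewrite (_ : (fun _ => _) = g) //; apply/funext => x; rewrite big_nil.
rewrite (_ : (fun _ => _) = f i \max (fun x => \big[Num.max/g x]_(j <- r) f j x)).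
  by move=> x; apply: continuous_max; [exact: cf | exact: IH].
by apply/funext => x; rewrite big_cons.
Qed.

Let continuous_sum (T : topologicalType) (I : Type) (r : seq I)
    (f : I -> T -> R) :
  (forall i, continuous (f i : T -> R^o)) ->
  continuous ((fun x => \sum_(i <- r) f i x) : T -> R^o).
Proof.
move=> cf; elim: r => [|i r IH].
  rewrite (_ : (fun _ => _) = cst 0); first exact: cst_continuous.
  by apply/funext => x; rewrite big_nil.
rewrite (_ : (fun _ => _) = f i \+ (fun x => \sum_(j <- r) f j x)).
  by move=> x; apply: (@continuousD _ R^o); [exact: cf | exact: IH].
by apply/funext => x; rewrite big_cons.
Qed.

Lemma opt_value_min (A : 'I_n -> 'M[R]_(m.+1, k.+1)) :
  (exists p : 'I_n -> 'cV[R]_k.+1, (forall t, simplex (p t)) /\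
     vmax (\sum_t A t *m p t) = opt_value A) /\
  (forall p : 'I_n -> 'cV[R]_k.+1, (forall t, simplex (p t)) ->
     opt_value A <= vmax (\sum_t A t *m p t)).
Proof.
pose dec (v : 'rV[R]_(n * k.+1)) : 'I_n -> 'cV[R]_k.+1 :=
  fun t => (row t (vec_mx v))^T.
pose enc (p : 'I_n -> 'cV[R]_k.+1) : 'rV[R]_(n * k.+1) :=
  mxvec (\matrix_(t, j) p t j 0).
have decE v t j : dec v t j 0 = v ord0 (mxvec_index t j).
  by rewrite /dec !mxE.
have encK p t : dec (enc p) t = p t.
  apply/matrixP => j i; rewrite (ord1 i) decE /enc.
  by rewrite mxvecE mxE.
pose D : set 'rV[R]_(n * k.+1) := [set v | forall t, simplex (dec v t)].
pose f (v : 'rV[R]_(n * k.+1)) := vmax (\sum_t A t *m dec v t).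
have ccoord i : continuous (fun v : 'rV[R]_(n * k.+1) => v ord0 i : R^o).
  exact: coord_continuous.
have cdec t j : continuous (fun v => dec v t j 0 : R^o).
  have -> : (fun v => dec v t j 0) = fun v => v ord0 (mxvec_index t j).
    by apply/funext => v; rewrite decE.
  exact: ccoord.
have cf : continuous (f : _ -> R^o).
  have cent (i : 'I_m.+1) :
      continuous ((fun v => (\sum_t A t *m dec v t) i 0) : _ -> R^o).
    rewrite (_ : (fun _ => _) =
        fun v => \sum_t \sum_j A t i j * dec v t j 0); last first.
      by apply/funext => v; rewrite summxE; apply: eq_bigr => t _; rewrite mxE.
    apply: continuous_sum => t; apply: continuous_sum => j x.
    apply: (@continuousM _ _ (fun=> A t i j)); last exact: cdec.
    exact: cst_continuous.
  rewrite /f /vmax => x; apply: continuous_bigmax; exact: cent.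
have D0 : D !=set0.
  exists (enc (fun=> delta_mx ord0 0)) => t; rewrite encK; split=> [j|].
    by rewrite mxE eqxx andbT; case: (j == ord0); rewrite ?lexx ler01.
  rewrite (bigD1 ord0) //= mxE !eqxx big1 ?addr0 // => j j0.
  by rewrite mxE (negbTE j0).
have Dcompact : compact D.
  have Bcompact : compact [set v : 'rV[R]_(n * k.+1) |
      forall i, `[(0 : R), (1 : R)]%classic (v ord0 i)].
    apply: (@rV_compact R _ (fun=> `[(0 : R), (1 : R)]%classic)) => _.
    exact: segment_compact.
  apply: subclosed_compact _ Bcompact _; last first.
    move=> v Dv i; case/mxvec_indexP: i => t j.
    by rewrite -decE /= in_itv /=; exact: (Dv t).1.
  have -> : D = \bigcap_(t in [set: 'I_n])
      ((\bigcap_(j in [set: 'I_k.+1]) ((fun v => dec v t j 0) @^-1` `[0, 1]))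
       `&` ((fun v => \sum_j dec v t j 0) @^-1` [set 1])).
    apply/seteqP; split=> [v Dv t _|v Dv t].
      by split=> [j _|] /=; [rewrite in_itv /=; exact: (Dv t).1|exact: (Dv t).2].
    have [D1 D2] := Dv t Logic.I; split=> // j.
    by have := D1 j Logic.I; rewrite /= in_itv.
  apply: closed_bigI => t _; apply: closedI.
    apply: closed_bigI => j _; apply: preimage_closed => [v _|]; first exact: cdec.
    exact: itv_closed.
  apply: preimage_closed => [v _|]; last exact: closed_eq.
  by apply: continuous_sum => j; exact: cdec.
have [v vD vmin] := EVT_min_rV D0 Dcompact (continuous_subspaceT cf).
rewrite inE in vD.
set S := [set vmax (\sum_t A t *m p t) |
   p in [set p : 'I_n -> 'cV[R]_k.+1 | forall t, simplex (p t)]].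
have lbS : lbound S (f v).
  move=> _ [p pD <-].
  have -> : vmax (\sum_t A t *m p t) = f (enc p).
    by rewrite /f; congr vmax; apply: eq_bigr => t _; rewrite encK.
  by apply: vmin; rewrite inE => t; rewrite encK; exact: pD.
have Sv : S (f v) by exists (dec v).
have optE : opt_value A = f v.
  apply/eqP; rewrite eq_le; apply/andP; split.
    by apply: ge_inf => //; exists (f v).
  by apply: lb_le_inf => //; exists (f v).
split=> [|p pD]; first by exists (dec v).
by rewrite optE; apply: lbS; exists p.
Qed.

End OptValueMin.

(* Main.v *)
Require Import Defs.
From mathcomp Require Import all_boot all_order all_algebra all_fingroup.
From mathcomp Require Import all_classical all_reals all_analysis.
From mathcomp Require Import ring lra zify.

Set Implicit Arguments.
Unset Strict Implicit.
Unset Printing Implicit Defensive.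

Import Order.TTheory GRing.Theory Num.Theory.

Local Open Scope ring_scope.

(** Let [p] be an optimal offline solution.  Since ExpertLB plays a best response
to the expert weights [w^t], the gain of the experts is at most the sum of the
[<w^t, A^t p^t>], so by the regret bound it suffices to control this sum over
each half of the arrivals.

First raise each row [t |-> (A^t p^t)_i] to one with total exactly [lambda*]:
well-boundedness then bounds its sum of squares by [3 gamma M lambda*].

For a random order, the mean of the not yet arrived entries of a row is a
martingale, with small increments during the first half.  A Bernstein-type
exponential potential keeps all these means below
[(1 + O(gamma eps)) lambda* / n].  As long as they are, the gain of the (adaptive)
weights has small drift, and a second exponential potential controls it.  The two
kinds of potentials are added up and handled by a single maximal inequality.  The
second half of a random order is distributed as its first half. *)

(** * Supermartingales along a uniformly random arrival order *)

Section Sampling.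
Variables (R : realType) (n : nat).
Implicit Types (s : 'S_n) (h : seq 'I_n) (F : seq 'I_n -> R).

Lemma mem_take_enum_ord t (u : 'I_n) : (u \in take t (enum 'I_n)) = (u < t)%N.
Proof.
rewrite -(mem_map val_inj) map_take val_enum_ord take_iota mem_iota /= add0n.
by rewrite leq_min ltn_ord andbT.
Qed.

Lemma card_notin h : uniq h -> #|[pred x | x \notin h]| = (n - size h)%N.
Proof.
move=> /card_uniqP sh; have := cardC (mem h).
by rewrite card_ord sh => /(congr1 (subn^~ (size h))) <-; rewrite addKn; exact: eq_card.
Qed.

Lemma mem_take_codom t s u : (s u \in take t (codom s)) = (u < t)%N.
Proof.
by rewrite codomE -map_take mem_map ?mem_take_enum_ord //; exact: perm_inj.
Qed.

Lemma size_codom_ord s : size (codom s) = n.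
Proof. by rewrite size_codom card_ord. Qed.

(** Both positions moved by the transposition are at least [t], so the first [t] arrivals are
    untouched and position [t] receives [s u]. *)
Lemma take_codom_tperm (t u : 'I_n) s : (t <= u)%N ->
  take t.+1 (codom (tperm t u * s)%g) = rcons (take t (codom s)) (s u).
Proof.
move=> tu.
rewrite (take_nth (s u)) ?size_codom_ord //; congr rcons.
  rewrite !codomE -!(map_take _ _ (enum 'I_n)); apply/eq_in_map => v.
  rewrite mem_take_enum_ord => vt; rewrite permM tpermD //.
    by apply/eqP => tv; rewrite -tv ltnn in vt.
  by apply/eqP => uv; rewrite -uv ltnNge tu in vt.
by rewrite codomE (nth_map t) ?size_enum_ord // nth_ord_enum permM tpermL.
Qed.

(* Exchanging the t-th arrival with a later one preserves the uniform
   distribution, so averaging over this exchange averages the t-th arrival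
   over the elements that have not arrived yet. *)
Lemma sampling_supermartingale F T : (T <= n)%N ->
  (forall h, uniq h -> (size h < T)%N ->
     \sum_(x | x \notin h) F (rcons h x) <= (n - size h)%:R * F h) ->
  \sum_(s : 'S_n) F (take T (codom s)) <= #|{: 'S_n}|%:R * F [::].
Proof.
elim: T => [|t IH] tn step.
  rewrite (eq_bigr (fun=> F [::])) => [|s _]; last by rewrite take0.
  by rewrite sumr_const mulr_natl.
apply: le_trans (IH (ltnW tn) _) => [|h uh ht]; last first.
  by apply: step => //; exact: ltnW.
pose t' := Ordinal tn.
have nt0 : 0 < (n - t)%:R :> R by rewrite ltr0n subn_gt0.
rewrite -(ler_pM2l nt0).
have cardt : #|[pred u : 'I_n | (t <= u)%N]| = (n - t)%N.
  rewrite -[in RHS](@size_takel t _ (enum 'I_n)) ?size_enum_ord ?(ltnW tn) //.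
  rewrite -card_notin ?take_uniq ?enum_uniq //; apply: eq_card => u.
  by rewrite !inE mem_take_enum_ord leqNgt.
have -> : (n - t)%:R * \sum_(s : 'S_n) F (take t.+1 (codom s)) =
    \sum_(s : 'S_n) \sum_(u : 'I_n | (t <= u)%N) F (rcons (take t (codom s)) (s u)).
  rewrite exchange_big /=.
  rewrite -cardt mulr_natl -sumr_const; apply: eq_bigr => u tu.
  rewrite (reindex_inj (mulgI (tperm t' u))); apply: eq_bigr => s _.
  by rewrite (@take_codom_tperm t').
rewrite mulr_sumr; apply: ler_sum => s _.
have sz : size (take t (codom s)) = t.
  by rewrite size_takel // size_codom_ord ltnW.
have := step (take t (codom s)).
rewrite sz take_uniq; last by rewrite codomE map_inj_uniq ?enum_uniq //; exact: perm_inj.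
move=> /(_ isT (leqnn _)); apply: le_trans.
(* [s] maps the positions from [t] on bijectively onto the elements outside the prefix. *)
rewrite [leRHS](reindex_inj (@perm_inj _ s)) le_eqVlt; apply/orP; left; apply/eqP.
by apply: eq_bigl => u; rewrite mem_take_codom leqNgt.
Qed.

(* The supermartingale property is only required while F stays below 1, as F is
   stopped when it reaches 1. *)
Lemma sampling_ville F T : (T <= n)%N -> (forall h, 0 <= F h) ->
  (forall h, uniq h -> (size h < T)%N -> F h < 1 ->
     \sum_(x | x \notin h) F (rcons h x) <= (n - size h)%:R * F h) ->
  #|[set s : 'S_n | 1 <= F (take T (codom s))]|%:R <= #|{: 'S_n}|%:R * F [::].
Proof.
move=> Tn F0 step.
pose hit h := has (fun j => 1 <= F (take j h)) (iota 0 (size h).+1).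
pose G h := if hit h then 1 else F h.
have G0 h : 0 <= G h by rewrite /G; case: ifP.
have hitP h : 1 <= F h -> hit h.
  by move=> Fh; apply/hasP; exists (size h); rewrite ?mem_iota ?add0n ?leqnn // take_size.
have hit_rcons h x : hit (rcons h x) = hit h || (1 <= F (rcons h x)).
  rewrite /hit size_rcons -addn1 iotaD has_cat add0n has_seq1.
  rewrite [X in _ || (1 <= F X)]take_oversize ?size_rcons //; congr orb.
  apply: eq_in_has => j.
  rewrite mem_iota add0n ltnS => /andP[_ jh].
  by rewrite -cats1 takel_cat.
have Gnil : G [::] <= F [::].
  by rewrite /G /hit /= orbF; case: ifP.
apply: (@le_trans _ _ (#|{: 'S_n}|%:R * G [::])); last first.
  by apply: ler_wpM2l.
apply: le_trans (@sampling_supermartingale G T Tn _) => [|h uh hT].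
  (* Markov's inequality for the stopped process [G]. *)
  rewrite -sum1_card natr_sum [leRHS](bigID (fun s => 1 <= F (take T (codom s)))) /=.
  rewrite -[leLHS]addr0 lerD ?sumr_ge0 //.
  under eq_bigl do rewrite inE.
  by apply: ler_sum => s Fs; rewrite /G hitP.
have [hh|nh] := boolP (hit h).
  rewrite {2}/G hh mulr1 -(card_notin uh) -sum1_card natr_sum.
  by apply: ler_sum => x _; rewrite /G hit_rcons hh.
have Fh : F h < 1 by rewrite ltNge; apply: contra nh; exact: hitP.
have -> : G h = F h by rewrite /G (negbTE nh).
apply: le_trans (step _ uh hT Fh); apply: ler_sum => x _.
by rewrite /G hit_rcons (negbTE nh) /=; case: ifP.
Qed.

End Sampling.

(** * Exponential potentials for sampling without replacement *)

Section Concentration.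
Variable R : realType.

(** Since [expR (- x) >= 1 - x], it suffices that [(1 + x + 2 * x ^+ 2) * (1 - x) = 1 + x ^+ 2 * (1
    - 2 * x)] is at least 1. *)
Lemma expR_le_quadratic (x : R) : x <= 1 / 2 -> expR x <= 1 + x + 2 * x ^+ 2.
Proof.
move=> x2; have q0 : 0 <= 1 + x + 2 * x ^+ 2 by nra.
rewrite -[leLHS]mul1r -ler_pdivlMr ?expR_gt0 // -expRN.
apply: (@le_trans _ _ ((1 + x + 2 * x ^+ 2) * (1 - x))).
  have : 0 <= x ^+ 2 * (1 - 2 * x) by rewrite mulr_ge0 ?sqr_ge0 //; lra.
  by rewrite (_ : (1 + x + 2 * x ^+ 2) * (1 - x) = 1 + x ^+ 2 * (1 - 2 * x)); [lra|ring].
by apply: ler_wpM2l => //; exact: expR_ge1Dx.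
Qed.

(** One-step moment bound of Bernstein type: [mu] bounds the mean and [v] the second moment of a
    uniformly drawn [u i]. *)
Lemma sum_expR_le (I : finType) (P : pred I) (u : I -> R) (r mu v : R) :
  r = #|P|%:R -> (forall i, P i -> u i <= 1 / 2) ->
  \sum_(i | P i) u i <= r * mu -> \sum_(i | P i) u i ^+ 2 <= r * v ->
  \sum_(i | P i) expR (u i) <= r * expR (mu + 2 * v).
Proof.
move=> rE u2 umu uv; have r0 : 0 <= r by rewrite rE.
apply: (@le_trans _ _ (\sum_(i | P i) (1 + u i + 2 * u i ^+ 2))).
  by apply: ler_sum => i /u2; exact: expR_le_quadratic.
rewrite !big_split /= -mulr_sumr sumr_const -rE.
apply: (@le_trans _ _ (r * (1 + (mu + 2 * v)))); first by lra.
by apply: ler_wpM2l => //; exact: expR_ge1Dx.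
Qed.

(** The variance of [a] under the weights [w] is nonnegative. *)
Lemma weighted_mean_sqr_le (I : finType) (w a : I -> R) :
  (forall i, 0 <= w i) -> \sum_i w i = 1 ->
  (\sum_i w i * a i) ^+ 2 <= \sum_i w i * a i ^+ 2.
Proof.
move=> w0 w1; set c := \sum_i w i * a i.
have : 0 <= \sum_i w i * (a i - c) ^+ 2.
  by apply: sumr_ge0 => i _; rewrite mulr_ge0 ?sqr_ge0.
rewrite (eq_bigr (fun i => w i * a i ^+ 2 + ((- 2 * c) * (w i * a i) + c ^+ 2 * w i))).
  by rewrite !big_split /= -!mulr_sumr w1 -/c; lra.
by move=> i _; ring.
Qed.

Lemma weighted_mean_le (I : finType) (w a : I -> R) (c : R) :
  (forall i, 0 <= w i) -> \sum_i w i = 1 -> (forall i, a i <= c) ->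
  \sum_i w i * a i <= c.
Proof.
move=> w0 w1 ac; rewrite -[leRHS]mul1r -w1 mulr_suml.
by apply: ler_sum => i _; apply: ler_wpM2l.
Qed.

Lemma weighted_mean_ge (I : finType) (w a : I -> R) (c : R) :
  (forall i, 0 <= w i) -> \sum_i w i = 1 -> (forall i, c <= a i) ->
  c <= \sum_i w i * a i.
Proof.
move=> w0 w1 ac; rewrite -[leLHS]mul1r -w1 mulr_suml.
by apply: ler_sum => i _; apply: ler_wpM2l.
Qed.

Section Process.
Variables (I : finType) (n T : nat).
Hypothesis n_double : n = (T + T)%N.
Variables (a : I -> 'I_n -> R) (S M V : R).
Hypotheses (T_gt0 : (0 < T)%N) (V_ge0 : 0 <= V) (M_ge0 : 0 <= M).
Hypothesis a_sum : forall i, \sum_x a i x = S.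
Hypothesis a_le : forall i x, `|a i x| <= M.
Hypothesis a_sqr : forall i, \sum_x a i x ^+ 2 <= V.
Variables (W : seq 'I_n -> I -> R) (Z : seq 'I_n -> R).
Hypothesis W_ge0 : forall h i, 0 <= W h i.
Hypothesis W_sum : forall h, \sum_i W h i = 1.
Hypothesis Z_nil : Z [::] = 0.
Hypothesis Z_rcons : forall h x, Z (rcons h x) <= Z h + \sum_i W h i * a i x.
Variables (theta d d' : R).
Hypotheses (theta_ge0 : 0 <= theta) (theta_le : theta * (4 * M) <= 1 / 2).

(** The mean of the entries still to arrive, times [n], so that it starts at the row total [S]. *)
Definition scaled_mean (h : seq 'I_n) (i : I) : R :=
  n%:R * (\sum_(x | x \notin h) a i x) / (n%:R - (size h)%:R).

(** The second summand pays in advance for the variance of the steps left until time [T]. As it is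
    nonnegative up to then, a value below 1 forces [scaled_mean h i <= S + d]. *)
Definition mean_potential (h : seq 'I_n) (i : I) : R :=
  expR (theta * (scaled_mean h i - S - d)
        + 16 * theta ^+ 2 * V / n%:R * (T%:R - (size h)%:R)).

(** Each arrival is charged its largest allowed drift and a variance term; [d'] is the final
    slack. *)
Definition gain_potential (h : seq 'I_n) : R :=
  expR (theta * Z h
        - (theta * (S + d) / n%:R + 4 * theta ^+ 2 * V / n%:R) * (size h)%:R
        - theta * d').

Lemma sum_notin_rcons (f : 'I_n -> R) (h : seq 'I_n) x : x \notin h ->
  \sum_(y | y \notin rcons h x) f y = \sum_(y | y \notin h) f y - f x.
Proof.
move=> xh; rewrite (bigD1 x xh) /= addrC addrK; apply: eq_bigl => y.
by rewrite mem_rcons inE negb_or andbC.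
Qed.

Lemma natr_n : n%:R = 2 * T%:R :> R.
Proof. by rewrite n_double natrD; ring. Qed.

Lemma T_le_n : (T <= n)%N. Proof. by rewrite n_double leq_addr. Qed.

Lemma T_gt0r : 0 < T%:R :> R. Proof. by rewrite ltr0n. Qed.

Lemma sum_notin_sqr_le (h : seq 'I_n) i : \sum_(x | x \notin h) a i x ^+ 2 <= V.
Proof.
apply: le_trans (a_sqr i); rewrite [leRHS](bigID (fun x => x \notin h)) /=.
by rewrite lerDl sumr_ge0 // => x _; exact: sqr_ge0.
Qed.

(** With [r] entries left of mean [y], the arrival of [x] changes the scaled mean by
    [n / (r - 1) * (y - a i x)]. These increments average to 0, and their second moment is covered
    by the decrease of the variance term. *)
Lemma mean_potential_step (h : seq 'I_n) i : uniq h -> (size h < T)%N ->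
  \sum_(x | x \notin h) mean_potential (rcons h x) i
    <= (n - size h)%:R * mean_potential h i.
Proof.
move=> uh hT; set r : R := (n - size h)%:R.
have T0 := T_gt0r; have nE := natr_n.
have rE : r = n%:R - (size h)%:R.
  by rewrite /r natrB // (leq_trans (ltnW hT)) // T_le_n.
have rT : T%:R + 1 <= r.
  by rewrite rE nE; have : (size h).+1%:R <= T%:R :> R by [rewrite ler_nat]; rewrite -natr1; lra.
have card_r : r = #|[pred x | x \notin h]|%:R by rewrite card_notin.
set Q := \sum_(x | x \notin h) a i x.
pose y := Q / r; have yQ : Q = y * r by rewrite /y divfK //; apply/eqP; lra.
pose u x := theta * (n%:R / (r - 1) * (y - a i x)).
have uE x : x \notin h -> mean_potential (rcons h x) i =
    mean_potential h i * expR (u x - 16 * theta ^+ 2 * V / n%:R).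
  move=> xh; rewrite /mean_potential -expRD; congr expR.
  rewrite /scaled_mean sum_notin_rcons // -/Q size_rcons -natr1.
  rewrite (_ : n%:R - ((size h)%:R + 1) = r - 1); last by rewrite rE; ring.
  rewrite -rE /u yQ.
  by field; rewrite nE; apply/and3P; split; apply/eqP; lra.
rewrite (eq_bigr _ uE) -mulr_sumr mulrC; apply: ler_wpM2r; first exact: expR_ge0.
rewrite (eq_bigr (fun x => expR (u x) * expR (- (16 * theta ^+ 2 * V / n%:R)))); last first.
  by move=> x _; rewrite expRD.
rewrite -mulr_suml expRN -ler_pdivlMr ?invr_gt0 ?expR_gt0 // invrK.
have sum_dev : \sum_(x | x \notin h) (y - a i x) = 0.
  by rewrite sumrB sumr_const -/Q -[y *+ _]mulr_natl -card_r yQ mulrC subrr.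
have y_sqr : \sum_(x | x \notin h) (y - a i x) ^+ 2 <= V.
  apply: le_trans (sum_notin_sqr_le h i).
  rewrite (eq_bigr (fun x => y * (y - a i x) - y * a i x + a i x ^+ 2)); last by move=> x _; ring.
  rewrite !big_split /= -mulr_sumr sum_dev mulr0 add0r sumrN -mulr_sumr -/Q yQ.
  by rewrite gerDr mulrA oppr_le0 mulr_ge0 // ?sqr_ge0 -?expr2 //; lra.
have y_le : `|y| <= M.
  rewrite /y normrM normfV (gtr0_norm (_ : 0 < r)); last by lra.
  rewrite ler_pdivrMr; last by lra.
  apply: le_trans (ler_norm_sum _ _ _) _; rewrite card_r mulr_natr -sumr_const.
  by apply: ler_sum => x _; exact: a_le.
(* Before time [T] at least [T + 1] entries remain, hence [n / (r - 1) <= n / T = 2]; this is why a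
   phase covers only half of the arrivals. *)
have nr : 0 <= n%:R / (r - 1) <= 2.
  by rewrite divr_ge0 //=; [rewrite ler_pdivrMr ?nE; lra|lra].
have [nr0 nr2] := andP nr.
have -> : 16 * theta ^+ 2 * V / n%:R = 0 + 2 * (8 * theta ^+ 2 * V / n%:R).
  by field; rewrite nE; apply/eqP; lra.
apply: sum_expR_le => //.
- move=> x _; apply: le_trans theta_le; apply: ler_wpM2l => //.
  apply: (@le_trans _ _ (n%:R / (r - 1) * (M + M))).
    apply: ler_wpM2l => //; move: y_le (a_le i x); rewrite !ler_norml; lra.
  have := ler_wpM2r M_ge0 nr2; lra.
- by rewrite -!mulr_sumr sum_dev !mulr0.
- rewrite (eq_bigr (fun x => (theta ^+ 2 * (n%:R / (r - 1)) ^+ 2) * (y - a i x) ^+ 2)); last first.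
    by move=> x _; rewrite /u; ring.
  rewrite -mulr_sumr.
  apply: (@le_trans _ _ (theta ^+ 2 * 4 * V)).
    apply: ler_pM => //; [by rewrite mulr_ge0 ?sqr_ge0|by apply: sumr_ge0 => x _; exact: sqr_ge0|].
    apply: ler_wpM2l; first exact: sqr_ge0.
    by rewrite (_ : 4 = 2 ^+ 2) ?lerXn2r ?nnegrE //; ring.
  rewrite mulrA ler_pdivlMr; last by rewrite nE; lra.
  have : 0 <= theta ^+ 2 * V * (r - T%:R) by rewrite !mulr_ge0 ?sqr_ge0 //; lra.
  by rewrite nE; lra.
Qed.

(** The weights [W h] are fixed before the next arrival, so the expected gain is a weighted mean of
    the remaining row means, each at most [(S + d) / n]. The second moment is at most
    [V / r <= 2 * V / n], by convexity of the square. *)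
Lemma gain_potential_step (h : seq 'I_n) : uniq h -> (size h < T)%N ->
  (forall i, scaled_mean h i <= S + d) ->
  \sum_(x | x \notin h) gain_potential (rcons h x)
    <= (n - size h)%:R * gain_potential h.
Proof.
move=> uh hT mean_le; set r : R := (n - size h)%:R.
have T0 := T_gt0r; have nE := natr_n.
have rE : r = n%:R - (size h)%:R.
  by rewrite /r natrB // (leq_trans (ltnW hT)) // T_le_n.
have rT : T%:R <= r.
  by rewrite rE nE; have : (size h)%:R <= T%:R :> R by [rewrite ler_nat ltnW]; lra.
have card_r : r = #|[pred x | x \notin h]|%:R by rewrite card_notin.
have n0 : 0 < n%:R :> R by rewrite nE; lra.
pose X x := \sum_i W h i * a i x.
pose b := theta * (S + d) / n%:R + 4 * theta ^+ 2 * V / n%:R.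
have step x : gain_potential (rcons h x) <= gain_potential h * (expR (theta * X x) * expR (- b)).
  rewrite /gain_potential -/b -!expRD ler_expR size_rcons -[(size h).+1%:R]natr1.
  by have := ler_wpM2l theta_ge0 (Z_rcons h x); rewrite -/(X x); lra.
apply: le_trans (ler_sum _ (fun x _ => step x)) _.
rewrite -mulr_sumr mulrC; apply: ler_wpM2r; first exact: expR_ge0.
rewrite -mulr_suml expRN -ler_pdivlMr ?invr_gt0 ?expR_gt0 // invrK.
have X_le x : `|X x| <= M.
  rewrite ler_norml /X weighted_mean_ge ?weighted_mean_le // => i.
    by have := a_le i x; rewrite ler_norml => /andP[].
  by have := a_le i x; rewrite ler_norml => /andP[].
apply: le_trans (sum_expR_le (r := r) (mu := theta * (S + d) / n%:R)
  (v := 2 * theta ^+ 2 * V / n%:R) card_r _ _ _) _.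
- move=> x _; apply: le_trans theta_le; apply: ler_wpM2l => //.
  by move: (X_le x); rewrite ler_norml; lra.
- rewrite (_ : r * _ = theta * (r * (S + d) / n%:R)); last by ring.
  rewrite -mulr_sumr /X exchange_big /=; apply: ler_wpM2l => //.
  under eq_bigr do rewrite -mulr_sumr.
  apply: weighted_mean_le => // i.
  have := mean_le i; rewrite /scaled_mean -rE.
  rewrite ler_pdivrMr; last by lra.
  by rewrite ler_pdivlMr //; lra.
- rewrite (eq_bigr (fun x => theta ^+ 2 * X x ^+ 2)); last by move=> x _; ring.
  rewrite -mulr_sumr mulrA ler_pdivlMr //.
  have X_sqr : \sum_(x | x \notin h) X x ^+ 2 <= V.
    apply: le_trans (ler_sum _ (fun x _ => weighted_mean_sqr_le _ (W_ge0 h) (W_sum h))) _.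
    rewrite exchange_big /=; under eq_bigr do rewrite -mulr_sumr.
    by apply: weighted_mean_le => // i; exact: sum_notin_sqr_le.
  have : 0 <= theta ^+ 2 * V * (r - T%:R) by rewrite !mulr_ge0 ?sqr_ge0 //; lra.
  have : 0 <= theta ^+ 2 * n%:R * (V - \sum_(x | x \notin h) X x ^+ 2).
    by rewrite !mulr_ge0 ?sqr_ge0 //; lra.
  by rewrite nE; lra.
by rewrite ler_wpM2l // ?ler_expR /b; lra.
Qed.

(* The mean potentials are supermartingales; while they are below 1 no row has
   a remaining mean much above its total mean, and this is exactly what makes
   the gain potential a supermartingale as well. *)
Lemma sampling_gain_tail :
  #|[set s : 'S_n | (S + d) / 2 + 2 * theta * V + d' <= Z (take T (codom s))]|%:R
    <= #|{: 'S_n}|%:R *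
       (#|I|%:R * expR (8 * theta ^+ 2 * V - theta * d) + expR (- (theta * d'))).
Proof.
have T0 := T_gt0r; have nE := natr_n.
have n0 : 0 < n%:R :> R by rewrite nE; lra.
pose F h := \sum_i mean_potential h i + gain_potential h.
have F_ge0 h : 0 <= F h.
  by rewrite addr_ge0 ?expR_ge0 // sumr_ge0 // => i _; exact: expR_ge0.
have F_nil : F [::] = #|I|%:R * expR (8 * theta ^+ 2 * V - theta * d) + expR (- (theta * d')).
  rewrite /F /gain_potential Z_nil !mulr0 subr0 sub0r; congr (_ + _).
  rewrite mulr_natl -sumr_const; apply: eq_bigr => i _; congr expR.
  rewrite /scaled_mean (eq_bigl xpredT) => [|x]; last by rewrite in_nil.
  rewrite a_sum /= !subr0 nE; field; apply/eqP; lra.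
rewrite -F_nil; apply: le_trans (sampling_ville T_le_n F_ge0 _).
  rewrite ler_nat; apply/subset_leq_card/fintype.subsetP => s; rewrite !inE => Zs.
  rewrite -[1](@expR0 R) /F; apply: ler_wpDl.
    by apply: sumr_ge0 => i _; exact: expR_ge0.
  rewrite ler_expR size_takel; last by rewrite size_codom_ord T_le_n.
  have := ler_wpM2l theta_ge0 Zs.
  (* The total charge over [T = n / 2] steps; on the event, the final exponent of the gain potential
     is thus nonnegative. *)
  have -> : (theta * (S + d) / n%:R + 4 * theta ^+ 2 * V / n%:R) * T%:R =
     theta * ((S + d) / 2 + 2 * theta * V).
    by rewrite nE; field; apply/eqP; lra.
  by lra.
move=> h uh hT Fh; rewrite /F big_split /= mulrDr; apply: lerD.
  rewrite exchange_big mulr_sumr; apply: ler_sum => i _.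
  exact: mean_potential_step.
apply: gain_potential_step => // i.
have : mean_potential h i < 1.
  apply: le_lt_trans Fh; rewrite /F (bigD1 i) //= -addrA lerDl addr_ge0 ?expR_ge0 //.
  by apply: sumr_ge0 => j _; exact: expR_ge0.
rewrite /mean_potential expR_lt1 => lt0.
have hT' : (size h)%:R <= T%:R :> R by rewrite ler_nat ltnW.
have V0 : 0 <= 16 * theta ^+ 2 * V / n%:R * (T%:R - (size h)%:R).
  apply: mulr_ge0; last by lra.
  by rewrite divr_ge0 ?(ltW n0) // !mulr_ge0 ?sqr_ge0.
rewrite leNgt; apply/negP => gt.
have dev : 0 <= scaled_mean h i - S - d by lra.
by have := mulr_ge0 theta_ge0 dev; lra.
Qed.

End Process.
End Concentration.

(** * Raising rows to a common total with controlled squares *)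

Section RaiseRows.
Variables (R : realType) (I : finType).

(** Every entry is moved towards the cap [U] by the same fraction [c] of its distance. *)
Lemma raise_to_sum (a : I -> R) (U lam : R) :
  (forall x, a x <= U) -> \sum_x a x <= lam -> lam <= #|I|%:R * U ->
  exists b : I -> R, (forall x, a x <= b x <= U) /\ \sum_x b x = lam.
Proof.
set Q := \sum_x a x; move=> aU alam lamU.
(* When a is already constantly U this weight is 0 / 0 = 0, as needed. *)
pose c := (lam - Q) / (#|I|%:R * U - Q).
have [c0 c1] : 0 <= c /\ c <= 1.
  have [e0|e0] := eqVneq (#|I|%:R * U - Q) 0.
    by rewrite /c e0 invr0 mulr0 lexx ler01.
  have : 0 < #|I|%:R * U - Q by rewrite lt_def e0 subr_ge0 (le_trans alam).
  move=> p; split; rewrite /c; first by rewrite divr_ge0 ?(ltW p) // subr_ge0.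
  by rewrite ler_pdivrMr // mul1r lerD2r.
exists (fun x => a x + c * (U - a x)); split=> [x|].
  have := aU x; rewrite -subr_ge0 => Ua.
  by rewrite lerDl mulr_ge0 //=; have := ler_wpM2r Ua c1; rewrite mul1r; lra.
rewrite big_split /= -mulr_sumr sumrB sumr_const -/Q -mulr_natl.
have [e0|e0] := eqVneq (#|I|%:R * U - Q) 0; last by rewrite divfK //; lra.
by rewrite e0 mulr0; lra.
Qed.

(** As [b x ^+ 2 <= M * |b x|], it suffices to bound the sum of the [|b x|]. One-sidedness does
    this: [|b x| <= b x + 2 * g] when [b] is at least [- g], and [|b x| <= 2 * g - b x] when [b] is
    at most [g]. *)
Lemma raise_row (a : I -> R) (g M gamma lam : R) :
  1 <= gamma -> 0 <= M -> 0 <= lam -> lam <= #|I|%:R * M ->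
  #|I|%:R * g = gamma * lam -> 0 <= g ->
  (forall x, `|a x| <= M) -> \sum_x a x <= lam ->
  (forall x, - g <= a x) \/ (forall x, a x <= g) ->
  exists b : I -> R, [/\ forall x, a x <= b x, forall x, `|b x| <= M,
    \sum_x b x = lam & \sum_x b x ^+ 2 <= 3 * gamma * M * lam].
Proof.
move=> gamma1 M0 lam0 lamM gE g0 aM alam aside.
have glam : lam <= gamma * lam by rewrite ler_peMl.
suff [b [ab bM bsum babs]] : exists b : I -> R, [/\ forall x, a x <= b x,
    forall x, b x <= M, \sum_x b x = lam & \sum_x `|b x| <= 3 * (gamma * lam)].
  have bM' x : `|b x| <= M.
    by have := aM x; have := ab x; have := bM x; rewrite !ler_norml; lra.
  exists b; split=> //; apply: (@le_trans _ _ (M * \sum_x `|b x|)).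
    rewrite mulr_sumr; apply: ler_sum => x _.
    by rewrite -real_normK ?num_real // expr2 ler_wpM2r.
  by have := ler_wpM2l M0 babs; lra.
case: aside => ag.
  have aM' x : a x <= M by have := aM x; rewrite ler_norml => /andP[].
  have [b [ab bsum]] := raise_to_sum aM' alam lamM.
  exists b; split=> // [x|x|]; try by have /andP[] := ab x.
  apply: (@le_trans _ _ (\sum_x (b x + 2 * g))).
    apply: ler_sum => x _; have /andP[abx _] := ab x; have := ag x.
    by rewrite ler_norml; lra.
  by rewrite big_split /= sumr_const -[_ *+ #|_|]mulr_natl mulrCA gE bsum; lra.
(* Here the cap must preserve the bound [g]; the total [lam] stays reachable because
   [#|I| * g = gamma * lam >= lam]. *)
have aU x : a x <= Num.min g M.
  by rewrite le_min ag; have := aM x; rewrite ler_norml => /andP[].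
have lamU : lam <= #|I|%:R * Num.min g M by rewrite minEle; case: ifP => // _; rewrite gE.
have [b [ab bsum]] := raise_to_sum aU alam lamU.
have bU x : b x <= g /\ b x <= M.
  by have /andP[_] := ab x; rewrite le_min => /andP.
exists b; split=> // [x|x|]; [by have /andP[] := ab x|by have [] := bU x|].
apply: (@le_trans _ _ (\sum_x (2 * g - b x))).
  by apply: ler_sum => x _; have [bg _] := bU x; rewrite ler_norml; lra.
by rewrite sumrB sumr_const -[_ *+ #|_|]mulr_natl mulrCA gE bsum; lra.
Qed.

End RaiseRows.

(** * The signed maximum *)

Section VMax.
Variables (R : realType) (m : nat).
Implicit Types u v : 'cV[R]_m.+1.

Lemma le_vmax v i : v i 0 <= vmax v.
Proof. by exact: (le_bigmax _ (fun i => v i 0)). Qed.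

Lemma vmax_le v (c : R) : (forall i, v i 0 <= c) -> vmax v <= c.
Proof. by move=> vc; apply/bigmax_leP; split. Qed.

Lemma vmaxD u v : vmax (u + v) <= vmax u + vmax v.
Proof. by apply: vmax_le => i; rewrite mxE lerD ?le_vmax. Qed.

Lemma vmax0 : vmax (0 : 'cV[R]_m.+1) = 0.
Proof.
apply/eqP; rewrite eq_le vmax_le => [/=|i]; last by rewrite mxE.
by have := le_vmax 0 ord0; rewrite mxE.
Qed.

Lemma vabs0 : vabs (0 : 'cV[R]_m) = 0.
Proof. by apply/matrixP => i j; rewrite !mxE normr0. Qed.

End VMax.

(** * Regret of multiplicative weights *)

Section MultiplicativeWeights.
Variable R : realType.

(** Using [expR (- z) >= 1 - z] at [z = x - x ^+ 2] would need [1 + x ^+ 3 >= 1], false for negative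
    [x]. Using it twice at the half [y = z / 2] gains a quadratic term, which dominates the cubic
    one for small [x]. *)
Lemma expR_le_1Dx (x : R) : - (1 / 10) <= x -> x <= 1 / 10 ->
  expR (x - x ^+ 2) <= 1 + x.
Proof.
move=> xl xu; pose y := (x - x ^+ 2) / 2.
have y_lt1 : 0 <= 1 - y by rewrite /y; nra.
have -> : x - x ^+ 2 = - (- y + - y) by rewrite /y; field.
rewrite expRN expRD -[_^-1]mul1r ler_pdivrMr ?mulr_gt0 ?expR_gt0 //.
apply: (@le_trans _ _ ((1 + x) * ((1 - y) * (1 - y)))).
  have gap : 0 <= x ^+ 2 * (x + (1 + x) * (1 - x) ^+ 2 / 4).
    have x2 : x ^+ 2 <= 1 / 100 by nra.
    have : 0 <= (1 + x) * x ^+ 2 by rewrite mulr_ge0 ?sqr_ge0 //; lra.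
    by move=> x3; rewrite mulr_ge0 ?sqr_ge0 //; lra.
  rewrite (_ : (1 + x) * _ = 1 + x ^+ 2 * (x + (1 + x) * (1 - x) ^+ 2 / 4)); first by lra.
  by rewrite /y; field.
by rewrite ler_wpM2l ?ler_pM ?expR_ge1Dx //; lra.
Qed.

Variables (m : nat) (eps M : R).
Hypotheses (eps_gt0 : 0 < eps) (eps_le : eps <= 1 / 10) (M_gt0 : 0 < M).
Implicit Types h : seq 'cV[R]_m.+1.

Lemma in_box_scaled (o : 'cV[R]_m.+1) i : in_box M o ->
  - eps <= eps * (o i 0 / M) <= eps.
Proof.
move=> /(_ i) /andP[lo up].
have : - 1 <= o i 0 / M <= 1 by rewrite ler_pdivlMr // ler_pdivrMr // mulN1r mul1r lo.
move=> /andP[lo' up'].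
by have := ler_wpM2l (ltW eps_gt0) lo'; have := ler_wpM2l (ltW eps_gt0) up'; lra.
Qed.

Lemma mwu_weight_gt0 h i : (forall o, o \in h -> in_box M o) ->
  0 < mwu_weight eps M h i.
Proof.
move=> hM; rewrite /mwu_weight big_seq; apply: prodr_gt0 => o /hM oM.
apply: (@lt_le_trans _ _ (1 - eps)); first by have e := eps_le; lra.
by rewrite lerD2l; have /andP[] := in_box_scaled i oM.
Qed.

Lemma mwu_total_gt0 h : (forall o, o \in h -> in_box M o) ->
  0 < \sum_i mwu_weight eps M h i.
Proof.
move=> hM; rewrite (bigD1 ord0) //= ltr_wpDr ?mwu_weight_gt0 //.
by apply: sumr_ge0 => i _; rewrite ltW ?mwu_weight_gt0.
Qed.

Lemma mwu_experts : experts_algorithm M (@mwu R m.+1 eps M).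
Proof.
move=> h hM; have tot := mwu_total_gt0 hM; have w0 i := mwu_weight_gt0 i hM.
split=> [i|]; rewrite /mwu.
  rewrite mxE; apply/andP; split; first by rewrite divr_ge0 // ltW.
  rewrite ler_pdivrMr // mul1r (bigD1 i) //= lerDl.
  by apply: sumr_ge0 => j _; rewrite ltW.
by under eq_bigr do rewrite mxE; rewrite -mulr_suml divff // gt_eqF.
Qed.

Lemma mwu_weight_rcons h o i :
  mwu_weight eps M (rcons h o) i = mwu_weight eps M h i * (1 + eps * (o i 0 / M)).
Proof. by rewrite /mwu_weight -cats1 big_cat big_seq1. Qed.

(** The total weight is multiplied by [1 + eps / M * g t] at each step, which bounds it above
    through the gains, while each single weight bounds it below through the rewards of one expert.
    Comparing logarithms gives the regret. *)
Lemma mwu_regret n :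
  has_regret n M (@mwu R m.+1 eps M) eps (M * ln m.+1%:R / eps).
Proof.
move=> o oM.
pose g t := ((mwu eps M (mkseq o t))^T *m o t) 0 0.
have hM t : (t <= n)%N -> forall x, x \in mkseq o t -> in_box M x.
  move=> tn x /mapP[j]; rewrite mem_iota add0n => /andP[_ jt] ->.
  exact: oM (leq_trans jt tn).
have upper t : (t <= n)%N -> \sum_i mwu_weight eps M (mkseq o t) i <=
    expR (ln m.+1%:R + eps / M * \sum_(j < t) g j).
  elim: t => [|t IH] tn.
    rewrite big_ord0 mulr0 addr0 lnK ?posrE ?ltr0n //.
    under eq_bigr do rewrite /mwu_weight big_nil.
    by rewrite sumr_const card_ord.
  set Wt := \sum_i mwu_weight eps M (mkseq o t) i.
  have Wt0 : 0 < Wt by apply: mwu_total_gt0; exact: hM (ltnW tn).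
  have totS : \sum_i mwu_weight eps M (mkseq o t.+1) i = Wt * (1 + eps / M * g t).
    rewrite mkseqS; under eq_bigr do rewrite mwu_weight_rcons.
    rewrite /g mxE mulrDr mulr1 !mulr_sumr -big_split /=; apply: eq_bigr => i _.
    rewrite !mxE -/Wt mulrDr mulr1; congr (_ + _).
    by field; rewrite ?gt_eqF.
  have factor_ge0 : 0 <= 1 + eps / M * g t.
    rewrite -(pmulr_rge0 _ Wt0) -totS; apply: sumr_ge0 => i _.
    by apply/ltW/mwu_weight_gt0; exact: hM.
  rewrite totS big_ord_recr /= [in leRHS]mulrDr addrA expRD.
  by apply: ler_pM; rewrite ?expR_ge1Dx ?(ltW Wt0) ?(IH (ltnW tn)).
have lower i t : (t <= n)%N ->
    expR (eps / M * (\sum_(j < t) o j i 0 - eps * \sum_(j < t) `|o j i 0|)) <=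
    mwu_weight eps M (mkseq o t) i.
  elim: t => [|t IH] tn; first by rewrite !big_ord0 mulr0 subr0 mulr0 expR0 /mwu_weight big_nil.
  rewrite mkseqS mwu_weight_rcons !big_ord_recr /=.
  set x := eps * (o t i 0 / M).
  have otM := oM t tn.
  have /andP[xl xu] := in_box_scaled i otM; rewrite -/x in xl xu.
  rewrite (_ : eps / M * _ =
    eps / M * (\sum_(j < t) o j i 0 - eps * \sum_(j < t) `|o j i 0|) +
    (x - eps ^+ 2 * `|o t i 0| / M)); last by rewrite /x; field; rewrite gt_eqF.
  have e10 := eps_le.
  rewrite expRD ler_pM ?expR_ge0 ?IH //; first by rewrite ltnW.
  apply: le_trans (expR_le_1Dx (x := x) _ _); [|by lra|by lra].
  (* The quadratic loss is linear in [|o t i 0|] up to the factor [1 / M], because [|o t i 0| <= M];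
     this produces the discount. *)
  rewrite ler_expR lerD2l lerN2 /x exprMn -mulrA; apply: ler_wpM2l; first exact: sqr_ge0.
  rewrite expr_div_n -real_normK ?num_real // expr2 -mulrA; apply: ler_wpM2l => //.
  rewrite expr2 invfM mulrA ler_pdivrMr // mulVf ?gt_eqF // ler_pdivrMr // mul1r.
  by have /andP[] := otM i; rewrite ler_norml => -> ->.
rewrite lerBlDr; apply: vmax_le => i.
have -> : (\sum_(t < n) o t - eps *: \sum_(t < n) vabs (o t)) i 0 =
    \sum_(t < n) o t i 0 - eps * \sum_(t < n) `|o t i 0|.
  by rewrite !mxE !summxE; congr (_ - _ * _); apply: eq_bigr => t _; rewrite mxE.
have : mwu_weight eps M (mkseq o n) i <= \sum_i mwu_weight eps M (mkseq o n) i.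
  rewrite (bigD1 i) //= lerDl; apply: sumr_ge0 => j _.
  by rewrite ltW // mwu_weight_gt0 //; exact: hM.
move=> /(le_trans (lower i n (leqnn n))) /le_trans /(_ (upper n (leqnn n))).
rewrite ler_expR => le_log.
have Me : 0 <= M / eps by rewrite divr_ge0 // ltW.
have := ler_wpM2l Me le_log.
have Me1 : M / eps * (eps / M) = 1 by field; rewrite !gt_eqF.
rewrite mulrA Me1 mul1r mulrDr [M / eps * (eps / M * _)]mulrA Me1 mul1r [M / eps * _ + _]addrC.
by rewrite [M / eps * _]mulrAC.
Qed.

End MultiplicativeWeights.

(** * The run of ExpertLB as two independent phases of rewards *)

Section ExpertLB.
Variables (R : realType) (m k : nat).
Variables (w : seq 'cV[R]_m -> 'cV[R]_m)
  (pick : nat -> 'cV[R]_m -> 'M[R]_(m, k) -> 'cV[R]_k).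
Implicit Types (h : seq 'cV[R]_m) (As : seq 'M[R]_(m, k)).

(* The rewards fed to the experts in a phase without restart. *)
Fixpoint rewards (t : nat) h As : seq 'cV[R]_m :=
  if As is A :: As' then rewards t.+1 (rcons h (A *m pick t (w h) A)) As' else h.

Lemma rewards_rcons t h As A : rewards t h (rcons As A) =
  rcons (rewards t h As) (A *m pick (t + size As) (w (rewards t h As)) A).
Proof.
elim: As t h => [|B As IH] t h /=; first by rewrite addn0.
by rewrite IH addSnnS.
Qed.

Lemma size_rewards t h As : size (rewards t h As) = (size h + size As)%N.
Proof.
elim: As t h => [|B As IH] t h /=; first by rewrite addn0.
by rewrite IH size_rcons addSnnS.
Qed.

Definition loads As (ps : seq 'cV[R]_k) : seq 'cV[R]_m :=
  [seq x.1 *m x.2 | x <- zip As ps].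

Lemma size_expertLB_from n t h As : size (expertLB_from n w pick t h As) = size As.
Proof. by elim: As t h => //= A As IH t h; rewrite IH. Qed.

(** Past time [n./2] the restart test never succeeds again. *)
Lemma loads_after_restart n t h As : (n./2 < t)%N ->
  h ++ loads As (expertLB_from n w pick t h As) = rewards t h As.
Proof.
elim: As t h => [|A As IH] t h nt /=; first by rewrite cats0.
by rewrite gtn_eqF // -IH ?ltnS ?(ltnW nt) // cat_rcons.
Qed.

(** As times start at 1, the condition on [t + size As] says that the last matrix of [As] arrives at
    time [n./2], right before the history is cleared. *)
Lemma loads_expertLB_from n t h As As' : (0 < size As)%N ->
  (t + size As)%N = (n./2).+1 ->
  h ++ loads (As ++ As') (expertLB_from n w pick t h (As ++ As')) =
  rewards t h As ++ rewards (n./2).+1 [::] As'.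
Proof.
elim: As t h => [//|A [|B As] IH] t h _ tE /=.
  have {}tE : t = n./2 by move: tE; rewrite addn1 => -[].
  by rewrite tE eqxx -(@loads_after_restart n) // cat_rcons.
rewrite ltn_eqF; last by move: tE => /=; lia.
rewrite -[in RHS]/(rewards t.+1 _ (B :: As)) -IH //; last by move: tE => /=; lia.
by rewrite cat_rcons.
Qed.

Definition gain (o : seq 'cV[R]_m) : R :=
  \sum_(j < size o) ((w (take j o))^T *m nth 0 o j) 0 0.

Lemma gain_rcons o x : gain (rcons o x) = gain o + ((w o)^T *m x) 0 0.
Proof.
rewrite /gain size_rcons big_ord_recr /= -cats1 take_size_cat // nth_cat ltnn subnn.
congr (_ + _); apply: eq_bigr => j _.
by rewrite takel_cat ?(ltnW (ltn_ord j)) // nth_cat ltn_ord.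
Qed.

Lemma simplex_row_in_box (M : R) (A : 'M[R]_(m, k)) p :
  simplex p -> (forall i j, - M <= A i j <= M) -> in_box M (A *m p).
Proof.
move=> [p01 p1] AM i; rewrite mxE; under eq_bigr do rewrite mulrC.
have p0 j : 0 <= p j 0 by have /andP[] := p01 j.
by rewrite weighted_mean_ge ?weighted_mean_le // => j; have /andP[] := AM i j.
Qed.

Lemma rewards_in_box (M : R) t h As : minimizing_rule pick ->
  (forall o, o \in h -> in_box M o) ->
  (forall A, A \in As -> forall i j, - M <= A i j <= M) ->
  forall o, o \in rewards t h As -> in_box M o.
Proof.
move=> pickP; elim: As t h => [//|A As IH] t h hM AM /=; apply: IH; last first.
  by move=> B BAs; apply: AM; rewrite inE BAs orbT.
move=> o; rewrite mem_rcons inE => /orP[/eqP ->|/hM //].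
apply: simplex_row_in_box; first by have [] := pickP t (w h) A.
by apply: AM; rewrite mem_head.
Qed.

End ExpertLB.

(** * Regret over a phase shorter than [n] *)

Section Regret.
Variables (R : realType) (n m : nat) (M alpha Rg : R).
Variable w : seq 'cV[R]_m.+1 -> 'cV[R]_m.+1.
Hypothesis w_regret : has_regret n M w alpha Rg.

Lemma in_box0 (M' : R) : 0 <= M' -> in_box M' (0 : 'cV[R]_m.+1).
Proof. by move=> M0 i; rewrite mxE oppr_le0 M0. Qed.

(** The default value of [nth 0 o] pads [o] with zero rewards up to length [n]; these change neither
    the gain nor the benchmark. *)
Lemma gain_regret (o : seq 'cV[R]_m.+1) : 0 <= M -> (size o <= n)%N ->
  (forall x, x \in o -> in_box M x) ->
  vmax (\sum_(x <- o) x - alpha *: \sum_(x <- o) vabs x) - Rg <= gain w o.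
Proof.
move=> M0 on oM.
have pad (V : zmodType) (f : nat -> V) : (forall t, (size o <= t)%N -> f t = 0) ->
    \sum_(t < n) f t = \sum_(t < size o) f t.
  move=> f0; rewrite -!(big_mkord xpredT f) (big_cat_nat (n := size o)) //=.
  by rewrite [X in _ + X]big_nat_cond [X in _ + X]big1 ?addr0 // => t /andP[/andP[/f0]].
have := @w_regret (fun t => nth 0 o t).
rewrite (pad _ (fun t => nth 0 o t)); last by move=> t ot; rewrite nth_default.
rewrite (pad _ (fun t => vabs (nth 0 o t))); last first.
  by move=> t ot; rewrite nth_default // vabs0.
rewrite (pad _ (fun t => ((w (mkseq _ t))^T *m nth 0 o t) 0 0)); last first.
  by move=> t ot; rewrite nth_default // mulmx0 mxE.
rewrite -!(big_mkord xpredT (fun t => nth 0 o t)) -(big_mkord xpredT (fun t => vabs (nth 0 o t))).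
rewrite -(big_nth 0 xpredT (fun x => x)) -(big_nth 0 xpredT (fun x => vabs x)) => le_gain.
rewrite (le_trans (le_gain _)) // => [t _|].
  have [ot|ot] := ltnP t (size o); first by apply: oM; exact: mem_nth.
  by rewrite nth_default //; exact: in_box0.
have mkseq_take j : (j <= size o)%N -> mkseq (nth 0 o) j = take j o.
  by move=> jo; rewrite -[in RHS](mkseq_nth 0 o) /mkseq -map_take take_iota (minn_idPl jo).
rewrite le_eqVlt; apply/orP; left; apply/eqP; apply: eq_bigr => t _.
congr (((w _)^T *m _) 0 0).
by rewrite mkseq_take // ltnW.
Qed.

(** On zero rewards both the gain and the benchmark vanish. *)
Lemma regret_ge0 : ((0 < n)%N -> 0 <= M) -> 0 <= Rg.
Proof.
move=> M0; have := @w_regret (fun=> 0).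
rewrite !big1 => [|t _|t _|t _]; rewrite ?vabs0 ?mulmx0 ?mxE //.
  rewrite scaler0 subr0 vmax0 sub0r oppr_le0; apply=> t tn.
  by apply/in_box0/M0; exact: leq_ltn_trans tn.
Qed.

End Regret.

(** * Symmetry of the two halves and the union bound *)

Section Order.
Variables (R : realType) (n : nat).

(** Rotating the positions by [T] is a bijection on orders that exchanges the two halves. *)
Lemma card_drop_codom (P : pred (seq 'I_n)) T : (T + T = n)%N ->
  #|[set s : 'S_n | P (drop T (codom s))]| = #|[set s : 'S_n | P (take T (codom s))]|.
Proof.
move=> TT.
have : perm_eq (rot T (enum 'I_n)) (ord_tuple n) by rewrite perm_rot.
case/tuple_permP => r rE.
have codomM s : codom (r * s)%g = rot T (codom s).
  rewrite !codomE -map_rot rE -[RHS]map_comp; apply: eq_map => i.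
  by rewrite /= tnth_ord_tuple permM.
rewrite -[RHS](card_preimset _ (mulgI r)); apply: eq_card => s; rewrite !inE codomM.
by rewrite /rot take_size_cat // size_drop size_codom_ord -TT addnK.
Qed.

Lemma prob_order_ge (E B B' : {set 'S_n}) (delta : R) :
  (forall s, s \notin B -> s \notin B' -> s \in E) ->
  #|B|%:R <= #|{: 'S_n}|%:R * (delta / 2) ->
  #|B'|%:R <= #|{: 'S_n}|%:R * (delta / 2) ->
  1 - delta <= prob_order R E.
Proof.
move=> BE Bd Bd'.
have N0 : 0 < #|{: 'S_n}|%:R :> R by rewrite ltr0n; apply/card_gt0P; exists 1%g.
rewrite /prob_order ler_pdivlMr //.
have : (#|{: 'S_n}| <= #|E| + (#|B| + #|B'|))%N.
  rewrite -cardsT; apply: leq_trans (leq_trans (leq_card_setU E (B :|: B')) _).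
    apply/subset_leq_card/fintype.subsetP => s _; rewrite !inE.
    case sB: (s \in B); rewrite ?orbT //=; case sB': (s \in B'); rewrite ?orbT //=.
    by rewrite BE ?sB ?sB'.
  by rewrite leq_add2l leq_card_setU.
by rewrite -(ler_nat R) !natrD; lra.
Qed.

End Order.

(** * Tail bounds for ExpertLB, first for one phase and then for the whole run *)

Section LoadBalancing.
Variable R : realType.

Lemma loads_mktuple n m k (B : 'I_n -> 'M[R]_(m, k)) (ps : seq 'cV[R]_k) :
  size ps = n ->
  loads [seq B t | t : 'I_n] ps = [seq B t *m nth 0 ps t | t <- enum 'I_n].
Proof.
move=> sz; have szB : size [seq B t | t : 'I_n] = n by rewrite size_image card_ord.
apply: (@eq_from_nth _ 0); first by rewrite size_map size_zip szB sz minnn size_map size_enum_ord.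
move=> j; rewrite size_map size_zip szB sz minnn => jn.
rewrite (nth_map (0, 0)) ?size_zip ?szB ?sz ?minnn // nth_zip ?szB ?sz //=.
rewrite (nth_map (Ordinal jn)) ?size_enum_ord //.
rewrite (nth_map (Ordinal jn)) ?size_enum_ord //.
by rewrite (nth_ord_enum _ (Ordinal jn)).
Qed.

(** Subadditivity of [vmax] separates the phases before and after the restart. *)
Lemma discounted_load_split n m k (alpha : R) (w : seq 'cV[R]_m.+1 -> 'cV[R]_m.+1)
    pick (A : 'I_n -> 'M[R]_(m.+1, k)) (s : 'S_n) T :
  n = (T + T)%N -> (0 < T)%N ->
  let o1 := rewards w pick 1 [::] (map A (take T (codom s))) in
  let o2 := rewards w pick T.+1 [::] (map A (drop T (codom s))) in
  discounted_load alpha (fun t => A (s t)) (expertLB w pick A s) <=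
    vmax (\sum_(x <- o1) x - alpha *: \sum_(x <- o1) vabs x) +
    vmax (\sum_(x <- o2) x - alpha *: \sum_(x <- o2) vabs x).
Proof.
move=> nT T0; set o1 := rewards _ _ 1 _ _; set o2 := rewards _ _ T.+1 _ _.
cbv zeta; rewrite /discounted_load /expertLB.
set ps := expertLB_from _ _ _ _ _ _.
have sz : size ps = n by rewrite size_expertLB_from size_image card_ord.
have n2 : n./2 = T by rewrite nT addnn doubleK.
have AsE : [seq A (s u) | u : 'I_n] = map A (take T (codom s)) ++ map A (drop T (codom s)).
  by rewrite -map_cat cat_take_drop codomE -map_comp /image_mem enumT.
have loadsE : [seq A (s t) *m nth 0 ps t | t <- enum 'I_n] = o1 ++ o2.
  rewrite -(loads_mktuple (fun t => A (s t)) sz) /ps AsE.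
  have szT : size (map A (take T (codom s))) = T.
    by rewrite size_map size_takel // size_codom_ord nT leq_addr.
  by rewrite -[LHS]cat0s loads_expertLB_from ?n2 ?szT.
have sumE (f : 'cV[R]_m.+1 -> 'cV[R]_m.+1) :
    \sum_t f (A (s t) *m nth 0 ps t) = \sum_(x <- o1) f x + \sum_(x <- o2) f x.
  by rewrite -big_cat -loadsE big_map big_enum.
rewrite (sumE id) (sumE (@vabs R m.+1)) /=.
apply: le_trans (vmaxD _ _); rewrite scalerDr le_eqVlt; apply/orP; left; apply/eqP; congr vmax.
by rewrite opprD addrACA.
Qed.

Variables (n m k : nat) (A : 'I_n -> 'M[R]_(m.+1, k.+1)).

Lemma opt_value_le (M : R) : (forall t i j, - M <= A t i j <= M) ->
  opt_value A <= n%:R * M.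
Proof.
move=> AM; have [[p [pP <-]] _] := opt_value_min A; apply: vmax_le => i.
rewrite summxE -[in leRHS](card_ord n) mulr_natl -sumr_const; apply: ler_sum => t _.
by have /andP[] := simplex_row_in_box (pP t) (AM t) i.
Qed.

Variables (M gamma eps delta : R).
Variable pick : nat -> 'cV[R]_m.+1 -> 'M[R]_(m.+1, k.+1) -> 'cV[R]_k.+1.
Hypotheses (gamma_ge1 : 1 <= gamma) (A_wb : well_bounded M gamma A).
Hypotheses (eps_le : eps <= 1 / 84) (delta_gt0 : 0 < delta) (delta_le : delta <= eps).
Hypothesis opt_ge : 3 * M * ln (m.+1%:R / delta) / eps ^+ 2 <= opt_value A.
Hypothesis pickP : minimizing_rule pick.

Lemma ln_ratio_ge0 : 0 <= ln (m.+1%:R / delta).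
Proof.
have e := eps_le; have d := delta_le; have d0 := delta_gt0.
apply: ln_ge0; rewrite ler_pdivlMr // mul1r (@le_trans _ _ 1) ?ler1n //; lra.
Qed.

(** One phase, with an arbitrary starting time [t0] so that it serves both halves although [pick]
    depends on the time. *)
Lemma gain_tail T t0 (w : seq 'cV[R]_m.+1 -> 'cV[R]_m.+1) :
  n = (T + T)%N -> (0 < T)%N -> 0 < M -> experts_algorithm M w ->
  #|[set s : 'S_n | opt_value A * (1 / 2 + 39 / 2 * gamma * eps) <=
       gain w (rewards w pick t0 [::] (map A (take T (codom s))))]|%:R
    <= #|{: 'S_n}|%:R * (delta / 2) :> R.
Proof.
move=> nT T0 M0 wP; set lam := opt_value A.
have [AM Aside] := A_wb.
have e84 := eps_le; have d_le := delta_le; have d0 := delta_gt0; have g1 := gamma_ge1.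
have e0 : 0 < eps := lt_le_trans d0 d_le.
pose L := ln (m.+1%:R / delta); have L0 : 0 <= L := ln_ratio_ge0.
have lamL : 3 * L <= eps ^+ 2 * lam / M.
  by have := opt_ge; rewrite ler_pdivrMr ?exprn_gt0 // -/L -/lam ler_pdivlMr //; lra.
have lam0 : 0 <= lam.
  by apply: le_trans opt_ge; rewrite divr_ge0 ?sqr_ge0 // !mulr_ge0 // ltW.
have n0 : 0 < n%:R :> R by rewrite ltr0n nT addn_gt0 T0.
have [[p [pP popt]] _] := opt_value_min A.
have raise i : exists b : 'I_n -> R, [/\ forall x, (A x *m p x) i 0 <= b x,
    forall x, `|b x| <= M, \sum_x b x = lam & \sum_x b x ^+ 2 <= 3 * gamma * M * lam].
  have p_ge0 x j : 0 <= p x j 0 by have [/(_ j)/andP[]] := pP x.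
  have p_sum x : \sum_j p x j 0 = 1 by have [] := pP x.
  have loadE x : (A x *m p x) i 0 = \sum_j p x j 0 * A x i j.
    by rewrite mxE; apply: eq_bigr => j _; rewrite mulrC.
  apply: (@raise_row _ _ _ (gamma * lam / n%:R)) => //.
  - exact: ltW.
  - by rewrite card_ord; exact: opt_value_le.
  - by rewrite card_ord; field; rewrite gt_eqF.
  - by rewrite divr_ge0 ?(ltW n0) // mulr_ge0 // (le_trans _ g1).
  - by move=> x; rewrite ler_norml; exact: simplex_row_in_box (pP x) (AM x) i.
  - by rewrite /lam -popt -summxE; exact: le_vmax.
  - case: (Aside i) => side; [left|right] => x; rewrite loadE.
      by apply: weighted_mean_ge.
    by apply: weighted_mean_le.
have [b bP] := choice raise.
pose W (h : seq 'I_n) i := w (rewards w pick t0 [::] (map A h)) i 0.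
pose Z (h : seq 'I_n) := gain w (rewards w pick t0 [::] (map A h)).
have W_simplex h : simplex (w (rewards w pick t0 [::] (map A h))).
  by apply: wP => o; apply: rewards_in_box => // B /mapP[x _ ->].
have theta_ge0 : 0 <= eps / M by rewrite divr_ge0 // ltW.
have theta_le : eps / M * (4 * M) <= 1 / 2.
  by rewrite mulrCA divfK ?gt_eqF //; lra.
have V_ge0 : 0 <= 3 * gamma * M * lam.
  by rewrite !mulr_ge0 ?(ltW M0) // (le_trans _ g1).
have W_ge0 h i : 0 <= W h i by have [/(_ i)/andP[]] := W_simplex h.
have W_sum h : \sum_i W h i = 1 by have [] := W_simplex h.
have Z_nil : Z [::] = 0 by rewrite /Z /gain big_ord0.
(* The decision played is at least as good against the current weights as the offline optimum [p x],
   whose loads are below the raised rows [b]. *)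
have Z_rcons h x : Z (rcons h x) <= Z h + \sum_i W h i * b i x.
  rewrite /Z map_rcons rewards_rcons gain_rcons lerD2l.
  set wh := w _; have [_ /(_ _ (pP x))] := pickP (t0 + size (map A h)) wh (A x).
  rewrite -!mulmxA => /le_trans; apply; rewrite mxE; apply: ler_sum => i _.
  rewrite mxE; apply: ler_wpM2l; first exact: W_ge0.
  by have [] := bP i.
have b_sum i : \sum_x b i x = lam by have [] := bP i.
have b_le i x : `|b i x| <= M by have [_ /(_ x)] := bP i.
have b_sqr i : \sum_x b i x ^+ 2 <= 3 * gamma * M * lam by have [] := bP i.
(* With rate eps / M and these slacks, both exponents in the tail bound are at
   most - eps^2 gamma lam / M, hence at most - 3 L. *)
have tail := sampling_gain_tail nT T0 V_ge0 (ltW M0) b_sum b_le b_sqr W_ge0 W_sum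
  Z_nil Z_rcons (25 * gamma * eps * lam) (gamma * eps * lam) theta_ge0 theta_le.
(* [39 / 2 = 25 / 2 + 6 + 1]: half the slack of the means, the variance charge, and the final
   slack. *)
have levelE : (lam + 25 * gamma * eps * lam) / 2 + 2 * (eps / M) * (3 * gamma * M * lam) +
    gamma * eps * lam = lam * (1 / 2 + 39 / 2 * gamma * eps).
  by field; rewrite gt_eqF.
rewrite levelE in tail.
apply: le_trans tail _; apply: ler_wpM2l; first exact: ler0n.
have rate : 3 * L <= eps / M * (gamma * eps * lam).
  apply: (le_trans lamL); rewrite (_ : eps / M * _ = gamma * (eps ^+ 2 * lam / M)); last by ring.
  by rewrite ler_peMl // divr_ge0 ?(ltW M0) // mulr_ge0 ?sqr_ge0.
pose q := delta / m.+1%:R.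
have m0 : 0 < m.+1%:R :> R by rewrite ltr0n.
have q0 : 0 < q by rewrite divr_gt0.
have expL : expR (- L) = q by rewrite expRN /L lnK ?posrE ?divr_gt0 // invf_div.
have exp3L x : x <= 3 * - L -> expR x <= q ^+ 3.
  by move=> xL; rewrite -expL -expRM_natl ler_expR.
have mq : m.+1%:R * q = delta by rewrite /q mulrC divfK // gt_eqF.
have q_le : q <= delta by rewrite ler_pdivrMr // ler_peMr ?ler1n // ltW.
have bound1 : expR (8 * (eps / M) ^+ 2 * (3 * gamma * M * lam) -
    eps / M * (25 * gamma * eps * lam)) <= q ^+ 3.
  (* The variance contributes [8 * 3 = 24] units of [eps ^+ 2 * gamma * lam / M], so the slack
     factor 25 leaves exactly one. *)
  apply: exp3L; rewrite (_ : _ - _ = - (eps / M * (gamma * eps * lam))); first by lra.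
  by field; rewrite gt_eqF.
have bound2 : expR (- (eps / M * (gamma * eps * lam))) <= q ^+ 3 by apply: exp3L; lra.
apply: (@le_trans _ _ (m.+1%:R * q ^+ 3 + q ^+ 3)).
  by rewrite card_ord lerD // ler_wpM2l // ltW.
(* [m.+1 * q = delta] absorbs the union over the rows, leaving [delta * q ^+ 2 + q ^+ 3], which is
   at most [delta / 2] since [q <= delta] and [q ^+ 2 <= 1 / 4]. *)
rewrite exprS mulrA mq.
have q2 : q ^+ 2 <= 1 / 4 by nra.
have : 0 <= delta * (1 / 4 - q ^+ 2) by rewrite mulr_ge0 ?(ltW d0) //; lra.
have : 0 <= (delta - q) * q ^+ 2 by rewrite mulr_ge0 ?sqr_ge0 //; lra.
by lra.
Qed.

(** Outside the two bad events, of probability at most [delta / 2] each, the gains of the halves add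
    up to at most the stated multiple of the optimum, and each half costs one [Rg]. *)
Lemma expertLB_tail (w : seq 'cV[R]_m.+1 -> 'cV[R]_m.+1) (alpha Rg : R) :
  ~~ odd n -> 0 < M -> (0 < n)%N ->
  experts_algorithm M w -> has_regret n M w alpha Rg ->
  1 - delta <= prob_order R [set s : 'S_n |
    discounted_load alpha (fun t => A (s t)) (expertLB w pick A s)
      <= opt_value A * (1 + 39 * gamma * eps) + 2 * Rg].
Proof.
move=> n_even M0 n0 wP w_regret; pose T := n./2.
have nT : n = (T + T)%N by rewrite addnn even_halfK.
have T0 : (0 < T)%N by lia.
pose big t0 (h : seq 'I_n) := opt_value A * (1 / 2 + 39 / 2 * gamma * eps) <=
  gain w (rewards w pick t0 [::] (map A h)).
apply: (@prob_order_ge _ _ _ [set s : 'S_n | big 1%N (take T (codom s))]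
    [set s : 'S_n | big T.+1 (drop T (codom s))]); last first.
- by rewrite (card_drop_codom (big T.+1)) //; exact: gain_tail.
- exact: gain_tail.
move=> s; rewrite !inE /big -!ltNge => lt1 lt2.
apply: le_trans (discounted_load_split _ _ _ _ _ nT T0) _.
have half t0 (h : seq 'I_n) : (size h <= n)%N ->
    let o := rewards w pick t0 [::] (map A h) in
    vmax (\sum_(x <- o) x - alpha *: \sum_(x <- o) vabs x) - Rg <= gain w o.
  move=> hn; apply: (gain_regret w_regret); first exact: ltW.
    by rewrite size_rewards size_map.
  move=> o; apply: rewards_in_box => // B /mapP[x _ ->].
  by have [] := A_wb.
have h1 := half 1%N (take T (codom s)); have h2 := half T.+1 (drop T (codom s)).
rewrite size_take size_codom_ord in h1; rewrite size_drop size_codom_ord in h2.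
have := h1 _; have := h2 _; rewrite leq_subr => /(_ isT) {}h2.
have -> : ((if (T < n)%N then T else n) <= n)%N by case: ifP => // /ltnW.
by move=> /(_ isT) /= {}h1; rewrite /= in h2; lra.
Qed.

Lemma discounted_load_zero (alpha : R) (s : 'S_n) (p : 'I_n -> 'cV[R]_k.+1) :
  (forall t, A t = 0) -> discounted_load alpha (fun t => A (s t)) p = 0.
Proof.
move=> A0; rewrite /discounted_load !big1 => [||t _]; rewrite ?scaler0 ?subr0 ?vmax0 //.
  by move=> t _; rewrite A0 mul0mx vabs0.
by rewrite A0 mul0mx.
Qed.

Lemma opt_value_zero : (forall t, A t = 0) -> opt_value A = 0.
Proof.
move=> A0; have [[p [_ <-]] _] := opt_value_min A.
by rewrite big1 ?vmax0 // => t _; rewrite A0 mul0mx.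
Qed.

End LoadBalancing.

(** * Both guarantees, with vanishing instances treated apart *)

Theorem mainTheorem3 (R : realType) :
  exists c1 c1' : R, c1 < c1' /\
    forall (n m k : nat) (A : 'I_n -> 'M[R]_(m.+1, k.+1))
      (M gamma eps delta : R)
      (pick : nat -> 'cV[R]_m.+1 -> 'M[R]_(m.+1, k.+1) -> 'cV[R]_k.+1),
    ~~ odd n ->
    1 <= gamma ->
    well_bounded M gamma A ->
    eps <= 1 / 84%:R ->
    0 < delta -> delta <= eps ->
    3%:R * M * ln (m.+1%:R / delta) / eps ^+ 2 <= opt_value A ->
    minimizing_rule pick ->
    (forall (w : seq 'cV[R]_m.+1 -> 'cV[R]_m.+1) (alpha Rg : R),
       experts_algorithm M w ->
       has_regret n M w alpha Rg ->
       prob_order R [set s : 'S_n |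
         discounted_load alpha (fun t => A (s t)) (expertLB w pick A s)
           <= opt_value A * (1 + c1 * gamma * eps) + 2%:R * Rg]
         >= 1 - delta) /\
    prob_order R [set s : 'S_n |
      discounted_load eps (fun t => A (s t)) (expertLB (mwu eps M) pick A s)
        <= opt_value A * (1 + c1' * gamma * eps)]
      >= 1 - delta.
Proof.
(* [39] is twice the [39 / 2] of one phase. The additional 1 absorbs [2 * Rg] for multiplicative
   weights, as the lower bound on the optimum gives [3 * Rg <= opt_value A * eps]. *)
exists 39, 40; split; first by rewrite ltr_nat.
move=> n m k A M gamma eps delta pick n_even g1 A_wb e84 d0 d_le opt_ge pickP.
have e0 : 0 < eps := lt_le_trans d0 d_le.
have prob1 (E : {set 'S_n}) : (forall s, s \in E) -> 1 - delta <= prob_order R E.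
  by move=> E1; apply: (@prob_order_ge _ _ _ finset.set0 finset.set0) => // [|];
    rewrite cards0 mulr_ge0 // divr_ge0 // ltW.
(* The learning rate eps / M is junk for M = 0, but then the instance vanishes. *)
have [[M0 n0]|A0] : (0 < M /\ (0 < n)%N) \/ (forall t, A t = 0).
  have [M0|M0] := ltP 0 M; last first.
    right=> t; apply/matrixP => i j; rewrite mxE; have [/(_ t i j)/andP[lo up] _] := A_wb.
    by apply/eqP; rewrite eq_le (le_trans up M0) (le_trans _ lo) // oppr_ge0.
  have [n0|n0] := posnP n; last by left.
  by right=> t; have := ltn_ord t; rewrite {2}n0.
- split=> [w alpha Rg wP w_regret|].
    exact: (expertLB_tail g1 A_wb e84 d0 d_le opt_ge pickP n_even M0 n0 wP w_regret).
  have e10 : eps <= 1 / 10 by lra.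
  have := expertLB_tail g1 A_wb e84 d0 d_le opt_ge pickP n_even M0 n0
    (mwu_experts e0 e10 M0) (@mwu_regret _ _ _ _ e0 e10 M0 n).
  move=> /le_trans; apply; rewrite ler_wpM2r ?invr_ge0 // ler_nat.
  apply/subset_leq_card/fintype.subsetP => s; rewrite !inE => /le_trans; apply.
  have m0 : 0 < m.+1%:R :> R by rewrite ltr0n.
  have ln_le : ln m.+1%:R <= ln (m.+1%:R / delta) :> R.
    by rewrite ler_ln ?posrE ?divr_gt0 // ler_pdivlMr // ler_piMr ?(ltW m0) //; lra.
  have ln_ge : 0 <= ln m.+1%:R :> R by rewrite ln_ge0 // ler1n.
  have opt_M : 3 * (M * ln m.+1%:R / eps) <= opt_value A * eps.
    rewrite -ler_pdivrMr //; apply: le_trans opt_ge.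
    rewrite (_ : _ / eps = 3 * M * ln m.+1%:R / eps ^+ 2); last by field; rewrite gt_eqF.
    by rewrite ler_wpM2r ?invr_ge0 ?sqr_ge0 // ler_wpM2l // mulr_ge0 // ltW.
  have Rg0 : 0 <= M * ln m.+1%:R / eps by rewrite divr_ge0 ?mulr_ge0 ?(ltW M0) ?(ltW e0).
  have : opt_value A * eps <= gamma * (opt_value A * eps) by rewrite ler_peMl //; lra.
  by lra.
- have opt0 := opt_value_zero A0.
  split=> [w alpha Rg _ w_regret|]; apply: prob1 => s; rewrite inE.
    rewrite discounted_load_zero // opt0 mul0r add0r mulr_ge0 //.
    apply: (regret_ge0 w_regret) => n0; have [AM _] := A_wb.
    by have /andP[/le_trans] := AM (Ordinal n0) 0 0; move=> /[apply]; lra.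
  by rewrite discounted_load_zero // opt0 mul0r.
Qed.
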